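(* Any Leibniz crossed module $(\mathfrak n,\mathfrak q,\delta)$ admits at least one stem cover. In particular, any Leibniz algebra admits at least one stem cover.
   Context: Fix a field $\mathbb K$. A Leibniz algebra is a $\mathbb K$-vector space $\mathfrak q$ with a bilinear bracket satisfying $[x,[y,z]]=[[x,y],z]-[[x,z],y]$. A Leibniz action of $\mathfrak m$ on $\mathfrak n$ is a pair of bilinear maps $(m,n)\mapsto{}^{m}n$, $(n,m)\mapsto n^{m}$ with values in $\mathfrak n$ such that ${}^{[m,m']}n={}^{m}({}^{m'}n)+({}^{m}n)^{m'}$, ${}^{m}[n,n']=[{}^{m}n,n']-[{}^{m}n',n]$, $n^{[m,m']}=(n^{m})^{m'}-(n^{m'})^{m}$, $[n,n']^{m}=[n^{m},n']+[n,n'^{m}]$, ${}^{m}({}^{m'}n)=-{}^{m}(n^{m'})$, $[n,{}^{m}n']=-[n,n'^{m}]$. A Leibniz crossed module $(\mathfrak n,\mathfrak q,\delta)$ is a homomorphism $\delta:\mathfrak n\to\mathfrak q$ of Leibniz algebras with a Leibniz action of $\mathfrak q$ on $\mathfrak n$ such that $\delta({}^{q}n)=[q,\delta(n)]$, $\delta(n^{q})=[\delta(n),q]$, ${}^{\delta(n_1)}n_2=[n_1,n_2]=n_1^{\delta(n_2)}$. A homomorphism $(\varphi,\psi):(\mathfrak n,\mathfrak q,\delta)\to(\mathfrak n',\mathfrak q',\delta')$ is a pair of Leibniz homomorphisms with $\psi\delta=\delta'\varphi$, $\varphi({}^{q}n)={}^{\psi(q)}\varphi(n)$, $\varphi(n^{q})=\varphi(n)^{\psi(q)}$.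 The category is $\mathbf{XLb}$; kernels, quotients, intersections, inclusions, surjectivity and exactness are componentwise. Crossed ideals are normal subobjects, i.e. kernels of homomorphisms. Commutators: for crossed ideals $(\mathfrak s,\mathfrak h,\delta)$, $(\mathfrak t,\mathfrak j,\delta)$ of $(\mathfrak n,\mathfrak q,\delta)$, $[(\mathfrak s,\mathfrak h,\delta),(\mathfrak t,\mathfrak j,\delta)]=(\langle D_{\mathfrak h}(\mathfrak t),D_{\mathfrak j}(\mathfrak s)\rangle,[\mathfrak h,\mathfrak j],\delta|)$, where $D_{\mathfrak h}(\mathfrak t)=\{{}^{h}t,t^{h}\mid h\in\mathfrak h,t\in\mathfrak t\}$, similarly $D_{\mathfrak j}(\mathfrak s)$, and $[\mathfrak h,\mathfrak j]$ is generated by all $[x,y],[y,x]$, $x\in\mathfrak h,y\in\mathfrak j$. Schur multiplier: $\mathbf{XLb}$ has enough projectives (with respect to surjective homomorphisms). For a projective presentation $0\to(\mathfrak u,\mathfrak r,\mu)\to(\mathfrak m,\mathfrak f,\mu)\to(\mathfrak n,\mathfrak q,\delta)\to0$ (middle term projective), $\mathcal M(\mathfrak n,\mathfrak q,\delta)=\dfrac{(\mathfrak u,\mathfrak r,\mu)\cap[(\mathfrak m,\mathfrak f,\mu),(\mathfrak m,\mathfrak f,\mu)]}{[(\mathfrak u,\mathfrak r,\mu),(\mathfrak m,\mathfrak f,\mu)]}$, independent of the presentation up to isomorphism. A short exact sequence $0\to(\mathfrak a,\mathfrak b,\sigma)\to(\mathfrak h,\mathfrak p,\sigma)\to(\mathfrak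 n,\mathfrak q,\delta)\to0$ is a central extension if $[(\mathfrak a,\mathfrak b,\sigma),(\mathfrak h,\mathfrak p,\sigma)]=0$; a central extension is a stem extension if $(\mathfrak a,\mathfrak b,\sigma)\subseteq[(\mathfrak h,\mathfrak p,\sigma),(\mathfrak h,\mathfrak p,\sigma)]$, and a stem cover of $(\mathfrak n,\mathfrak q,\delta)$ if moreover $(\mathfrak a,\mathfrak b,\sigma)\cong\mathcal M(\mathfrak n,\mathfrak q,\delta)$. For a Leibniz algebra $\mathfrak q$: a stem cover is a short exact sequence $0\to\mathfrak b\to\mathfrak p\to\mathfrak q\to0$ of Leibniz algebras with $\mathfrak b$ contained in the (two-sided) center of $\mathfrak p$, $\mathfrak b\subseteq[\mathfrak p,\mathfrak p]$, and $\mathfrak b\cong(\mathfrak r\cap[\mathfrak f,\mathfrak f])/[\mathfrak r,\mathfrak f]$ (the Schur multiplier $HL_2(\mathfrak q)$) for a free presentation $0\to\mathfrak r\to\mathfrak f\to\mathfrak q\to0$, with $[\mathfrak r,\mathfrak f]$ generated by all $[r,f],[f,r]$. A Leibniz algebra $\mathfrak q$ is regarded as the crossed module $(0,\mathfrak q,i)$ or $(\mathfrak q,\mathfrak q,{\sf id})$. *)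

(* Defs.v *)
From HB Require Import structures.
From mathcomp Require Import all_boot all_algebra.
From mathcomp Require Import boolp.

Set Implicit Arguments.
Unset Strict Implicit.
Unset Printing Implicit Defensive.

Import GRing.Theory.
Local Open Scope ring_scope.
Local Open Scope quotient_scope.

(** * Subspaces and quotients of vector spaces *)

Record subspace (K : fieldType) (V : lmodType K) := Subspace {
  ssp :> {pred V};
  ssp_closed : submod_closed ssp
}.

HB.instance Definition _ (K : fieldType) (V : lmodType K) (S : subspace V) :=
  GRing.isSubmodClosed.Build K V (ssp S) (ssp_closed S).

Section SubQuotientSpace.
Variables (K : fieldType) (V : lmodType K) (S : subspace V).

Definition vsub : Type := {x : V | x \in ssp S}.
HB.instance Definition _ := SubChoice.on vsub.
HB.instance Definition _ := [SubChoice_isSubLmodule of vsub by <:].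

Definition vquot : Type := @Quotient.quot V (ssp S).
HB.instance Definition _ := GRing.Zmodule.on vquot.

Definition vquot_pi (x : V) : vquot := \pi_(vquot) x.

Lemma vquot_eqP x y : reflect (vquot_pi x = vquot_pi y) (x - y \in ssp S).
Proof. by rewrite Quotient.idealrBE; apply: eqP. Qed.

Lemma vquot_reprK (x : vquot) : vquot_pi (repr x) = x.
Proof. exact: reprK. Qed.

Lemma vquot_repr_pi x : repr (vquot_pi x) - x \in ssp S.
Proof. by apply/vquot_eqP; rewrite vquot_reprK. Qed.

Lemma vquot_piD x y : vquot_pi (x + y) = vquot_pi x + vquot_pi y.
Proof. by rewrite /vquot_pi !piE. Qed.

Definition vquot_scale (a : K) (x : vquot) : vquot := vquot_pi (a *: repr x).

Lemma vquot_piZ a x : vquot_scale a (vquot_pi x) = vquot_pi (a *: x).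
Proof. by apply/vquot_eqP; rewrite -scalerBr rpredZ ?vquot_repr_pi. Qed.

Fact vquot_scaleA a b v : vquot_scale a (vquot_scale b v) = vquot_scale (a * b) v.
Proof. by rewrite -[v]vquot_reprK !vquot_piZ scalerA. Qed.
Fact vquot_scale1 : left_id 1 vquot_scale.
Proof. by move=> v; rewrite -[v]vquot_reprK !vquot_piZ scale1r. Qed.
Fact vquot_scaleDr : right_distributive vquot_scale +%R.
Proof.
move=> a u v; rewrite -[u]vquot_reprK -[v]vquot_reprK.
by rewrite -vquot_piD !vquot_piZ scalerDr vquot_piD.
Qed.
Fact vquot_scaleDl v : {morph vquot_scale^~ v : a b / a + b}.
Proof.
by move=> a b; rewrite -[v]vquot_reprK !vquot_piZ scalerDl vquot_piD.
Qed.

HB.instance Definition _ := GRing.Zmodule_isLmodule.Build K vquot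
  vquot_scaleA vquot_scale1 vquot_scaleDr vquot_scaleDl.

Fact vquot_pi_linear : linear vquot_pi.
Proof. by move=> a x y; rewrite vquot_piD -vquot_piZ. Qed.

HB.instance Definition _ := GRing.isLinear.Build K V vquot *:%R vquot_pi
  vquot_pi_linear.

End SubQuotientSpace.

Section SubQuotientLinear.
Variables (K : fieldType) (V W : lmodType K).
Variables (S : subspace V) (T : subspace W) (f : {linear V -> W}).
Hypothesis fST : forall x, x \in ssp S -> f x \in ssp T.

Let fsub (x : vsub S) : vsub T := Sub (f (val x)) (fST (valP x)).
Fact linear_sub_subproof : linear fsub.
Proof. by move=> a x y; apply: val_inj; rewrite /= linearP. Qed.
Definition linear_sub : {linear vsub S -> vsub T} :=
  HB.pack_for {linear vsub S -> vsub T} fsub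
    (GRing.isLinear.Build K (vsub S) (vsub T) *:%R fsub linear_sub_subproof).

Let fquot (x : vquot S) : vquot T := vquot_pi T (f (repr x)).
Fact linear_quot_subproof x : fquot (vquot_pi S x) = vquot_pi T (f x).
Proof. by apply/vquot_eqP; rewrite -linearB fST ?vquot_repr_pi. Qed.
Fact linear_quot_linear : linear fquot.
Proof.
move=> a x y; rewrite -[x]vquot_reprK -[y]vquot_reprK -linearP.
by rewrite !linear_quot_subproof !linearP.
Qed.
Definition linear_quot : {linear vquot S -> vquot T} :=
  HB.pack_for {linear vquot S -> vquot T} fquot
    (GRing.isLinear.Build K (vquot S) (vquot T) *:%R fquot linear_quot_linear).

Lemma linear_quotE x : linear_quot (vquot_pi S x) = vquot_pi T (f x).
Proof. exact: linear_quot_subproof. Qed.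

End SubQuotientLinear.

Section SubQuotientBilinear.
Variables (K : fieldType) (U V W : lmodType K).
Variables (R : subspace U) (S : subspace V) (T : subspace W).
Variable b : {bilinear U -> V -> W}.

Section Sub.
Hypothesis bRS : forall x y, x \in ssp R -> y \in ssp S -> b x y \in ssp T.

Let bsub (x : vsub R) (y : vsub S) : vsub T :=
  Sub (b (val x) (val y)) (bRS (valP x) (valP y)).
Fact bilin_sub_subproof : bilinear_for *:%R *:%R bsub.
Proof.
split=> [y|x] a u v; apply: val_inj => /=.
  by rewrite linearPl.
by rewrite linearPr.
Qed.
Definition bilin_sub : {bilinear vsub R -> vsub S -> vsub T} :=
  HB.pack_for {bilinear vsub R -> vsub S -> vsub T} bsub
    (bilinear_isBilinear.Build K (vsub R) (vsub S) (vsub T) *:%R *:%R bsub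
       bilin_sub_subproof).
End Sub.

Section Quot.
Hypothesis bR : forall x y, x \in ssp R -> b x y \in ssp T.
Hypothesis bS : forall x y, y \in ssp S -> b x y \in ssp T.

Let bquot (x : vquot R) (y : vquot S) : vquot T :=
  vquot_pi T (b (repr x) (repr y)).
Fact bilin_quot_subproof x y :
  bquot (vquot_pi R x) (vquot_pi S y) = vquot_pi T (b x y).
Proof.
apply/vquot_eqP; set x' := repr _; set y' := repr _.
rewrite -(subrKA (b x y')) -linearBl -linearBr.
apply: rpredD; first by apply: bR; apply: vquot_repr_pi.
by apply: bS; apply: vquot_repr_pi.
Qed.
Fact bilin_quot_bilinear : bilinear_for *:%R *:%R bquot.
Proof.
split=> [y|x] a u v; rewrite -[u]vquot_reprK -[v]vquot_reprK.
  by rewrite -[y]vquot_reprK -linearP !bilin_quot_subproof linearPl linearP.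
by rewrite -[x]vquot_reprK -linearP !bilin_quot_subproof linearPr linearP.
Qed.
Definition bilin_quot : {bilinear vquot R -> vquot S -> vquot T} :=
  HB.pack_for {bilinear vquot R -> vquot S -> vquot T} bquot
    (bilinear_isBilinear.Build K (vquot R) (vquot S) (vquot T) *:%R *:%R bquot
       bilin_quot_bilinear).
Lemma bilin_quotE x y :
  bilin_quot (vquot_pi R x) (vquot_pi S y) = vquot_pi T (b x y).
Proof. exact: bilin_quot_subproof. Qed.
End Quot.

End SubQuotientBilinear.

(** Prevents [bilin_quotE] from rewriting up to unfolding *)
Local Opaque vquot_pi linear_quot bilin_quot.

Section Span.
Variables (K : fieldType) (V : lmodType K).

Inductive span_of (G : V -> Prop) : V -> Prop :=
| span_gen x : G x -> span_of G x
| span0 : span_of G 0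
| spanZD (a : K) x y : span_of G x -> span_of G y -> span_of G (a *: x + y).

Fact span_closed (G : V -> Prop) :
  submod_closed ((fun x => `[< span_of G x >]) : {pred V}).
Proof.
split; first exact/asboolP/span0.
by move=> a x y /asboolP Gx /asboolP Gy; apply/asboolP/spanZD.
Qed.

Definition span (G : V -> Prop) : subspace V := Subspace (span_closed G).

Lemma mem_span (G : V -> Prop) x : G x -> x \in ssp (span G).
Proof. by move=> Gx; apply/asboolP/span_gen. Qed.

Lemma span_sub (G : V -> Prop) (W : lmodType K) (f : V -> W) (T : subspace W) :
  linear f -> (forall x, G x -> f x \in ssp T) ->
  forall x, x \in ssp (span G) -> f x \in ssp T.
Proof.
move=> flin GT x /asboolP; elim=> [{}x /GT // | | a {}x y _ fx _ fy].
  have := flin (-1) 0 0; rewrite scaler0 add0r scaleN1r addNr => ->.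
  exact: rpred0.
by rewrite flin rpredD ?rpredZ.
Qed.

Fact full_closed : submod_closed ((fun _ => true) : {pred V}).
Proof. by split. Qed.
Definition full : subspace V := Subspace full_closed.

Fact inter_closed (S T : subspace V) :
  submod_closed ((fun x => (x \in ssp S) && (x \in ssp T)) : {pred V}).
Proof.
split=> [|a x y /andP[Sx Tx] /andP[Sy Ty]]; first by apply/andP; rewrite !rpred0.
by apply/andP; rewrite !rpredD ?rpredZ.
Qed.
Definition inter (S T : subspace V) : subspace V := Subspace (inter_closed S T).

Fact preim_closed (W : lmodType K) (f : {linear V -> W}) (T : subspace W) :
  submod_closed ((fun x => f x \in ssp T) : {pred V}).
Proof.
split=> [|a x y Tx Ty]; rewrite unfold_in; first by rewrite linear0 rpred0.
by rewrite linearP rpredD ?rpredZ.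
Qed.
Definition preim_space (W : lmodType K) (f : {linear V -> W}) (T : subspace W) :
  subspace V := Subspace (preim_closed f T).

Fact zero_closed : submod_closed ((fun x => x == 0) : {pred V}).
Proof.
split=> [|a x y /eqP -> /eqP ->]; rewrite unfold_in //.
by rewrite scaler0 addr0.
Qed.
Definition zero_space : subspace V := Subspace zero_closed.

End Span.

Definition ker_space (K : fieldType) (V W : lmodType K) (f : {linear V -> W}) :=
  preim_space f (zero_space W).

(** * Leibniz algebras *)

Record leibniz (K : fieldType) := Leibniz {
  lcar :> lmodType K;
  lbracket : {bilinear lcar -> lcar -> lcar};
  leibniz_identity : forall x y z : lcar,
    lbracket x (lbracket y z) =
    lbracket (lbracket x y) z - lbracket (lbracket x z) y
}.

Notation br := (@lbracket _ _).

Record lhom (K : fieldType) (L M : leibniz K) := LHom {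
  lhom_fun :> {linear L -> M};
  lhomM : forall x y : L, lhom_fun (br x y) = br (lhom_fun x) (lhom_fun y)
}.

(** Two-sided ideals *)
Record lideal (K : fieldType) (L : leibniz K) := LIdeal {
  lid :> subspace L;
  lid_brl : forall x y : L, x \in ssp lid -> br x y \in ssp lid;
  lid_brr : forall x y : L, y \in ssp lid -> br x y \in ssp lid
}.

Section LeibnizSubQuotient.
Variables (K : fieldType) (L : leibniz K) (I : lideal L).

Fact lsub_stable (x y : L) : x \in ssp I -> y \in ssp I -> br x y \in ssp I.
Proof. by move=> + _; apply: lid_brl. Qed.

Fact lsub_identity (x y z : vsub I) :
  bilin_sub lsub_stable x (bilin_sub lsub_stable y z) =
  bilin_sub lsub_stable (bilin_sub lsub_stable x y) z
  - bilin_sub lsub_stable (bilin_sub lsub_stable x z) y.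
Proof. by apply: val_inj; rewrite /= leibniz_identity. Qed.
Definition lsub : leibniz K := Leibniz lsub_identity.


Let qbr := bilin_quot (@lid_brl K L I) (@lid_brr K L I).
Fact lquot_identity (x y z : vquot I) :
  qbr x (qbr y z) = qbr (qbr x y) z - qbr (qbr x z) y.
Proof.
rewrite -[x]vquot_reprK -[y]vquot_reprK -[z]vquot_reprK.
by rewrite /qbr !bilin_quotE leibniz_identity linearB.
Qed.
Definition lquot : leibniz K := Leibniz lquot_identity.

Fact lquot_piM (x y : L) :
  vquot_pi I (br x y) = @lbracket K lquot (vquot_pi I x) (vquot_pi I y).
Proof. exact/esym/bilin_quotE. Qed.
Definition lquot_pi : lhom L lquot :=
  @LHom K L lquot (vquot_pi I : {linear L -> lquot}) lquot_piM.

End LeibnizSubQuotient.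

Section LeibnizIdeals.
Variables (K : fieldType) (L : leibniz K).

Definition lfull : lideal L :=
  @LIdeal K L (full L) (fun _ _ _ => isT) (fun _ _ _ => isT).

Definition linter (I J : lideal L) : lideal L.
Proof.
apply: (@LIdeal K L (inter I J)) => x y /andP[Ix Jx]; apply/andP.
  by rewrite !lid_brl.
by rewrite !lid_brr.
Defined.

Definition lker (M : leibniz K) (f : lhom L M) : lideal L.
Proof.
apply: (@LIdeal K L (ker_space f)) => x y fx; rewrite unfold_in /= unfold_in lhomM.
  by rewrite (eqP fx) linear0l.
by rewrite (eqP fx) linear0r.
Defined.

(** [lrestr I J] is the trace of [I] on the subalgebra [J]. *)
Definition lrestr (I J : lideal L) : lideal (lsub J).
Proof.
apply: (@LIdeal K (lsub J) (preim_space (val : {linear vsub J -> L}) I)) => x y Ix.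
  exact: (lid_brl (val y) Ix).
exact: (lid_brr (val x) Ix).
Defined.

(** The linear span of the brackets is already an ideal, hence it is also the
    subalgebra and the ideal that they generate. *)
Definition lcomm_gen (H J : lideal L) (z : L) : Prop :=
  exists x y : L, [/\ x \in ssp H, y \in ssp J & z = br x y \/ z = br y x].

Fact lcomm_brl (H J : lideal L) (x y : L) :
  x \in ssp (span (lcomm_gen H J)) -> br x y \in ssp (span (lcomm_gen H J)).
Proof.
apply: (span_sub (f := fun x => br x y)) => [a u v|_ [h [j [Hh Jj []->]]]].
- by rewrite linearPl.
- have -> : br (br h j) y = br h (br j y) + br (br h y) j.
    by rewrite leibniz_identity subrK.
  apply: rpredD; apply: mem_span.
    by exists h, (br j y); split; [|exact: lid_brl|left].
  by exists (br h y), j; split; [exact: lid_brl | |left].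
- have -> : br (br j h) y = br j (br h y) + br (br j y) h.
    by rewrite leibniz_identity subrK.
  apply: rpredD; apply: mem_span.
    by exists (br h y), j; split; [exact: lid_brl | |right].
  by exists h, (br j y); split; [|exact: lid_brl|right].
Qed.

Fact lcomm_brr (H J : lideal L) (y x : L) :
  x \in ssp (span (lcomm_gen H J)) -> br y x \in ssp (span (lcomm_gen H J)).
Proof.
apply: (span_sub (f := br y)) => [a u v|_ [h [j [Hh Jj []->]]]].
- by rewrite linearPr.
- rewrite leibniz_identity; apply: rpredB; apply: mem_span.
    by exists (br y h), j; split; [exact: lid_brr | |left].
  by exists h, (br y j); split; [|exact: lid_brr|right].
- rewrite leibniz_identity; apply: rpredB; apply: mem_span.
    by exists h, (br y j); split; [|exact: lid_brr|right].
  by exists (br y h), j; split; [exact: lid_brr | |left].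
Qed.

Definition lcomm (H J : lideal L) : lideal L :=
  LIdeal (@lcomm_brl H J) (@lcomm_brr H J).

Definition lcenter (z : L) : Prop := forall x : L, br z x = 0 /\ br x z = 0.

End LeibnizIdeals.

(** Isomorphisms are bijective homomorphisms. *)
Definition liso (K : fieldType) (L M : leibniz K) : Prop :=
  exists f : lhom L M, bijective f.

(** [0 -> lext_ker -> lext_mid -> L -> 0] *)
Record lext (K : fieldType) (L : leibniz K) := LExt {
  lext_ker : leibniz K;
  lext_mid : leibniz K;
  lext_i : lhom lext_ker lext_mid;
  lext_p : lhom lext_mid L;
  lext_inj : injective lext_i;
  lext_surj : forall y : L, exists x, lext_p x = y;
  lext_exact : forall x : lext_mid, lext_p x = 0 <-> exists a, x = lext_i a
}.

(** [F] is the free Leibniz algebra on some set. *)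
Definition lfree (K : fieldType) (F : leibniz K) : Prop :=
  exists (B : Type) (iota : B -> F), forall (L : leibniz K) (g : B -> L),
    exists2 h : lhom F L, (forall b, h (iota b) = g b) &
      forall h' : lhom F L, (forall b, h' (iota b) = g b) -> h' =1 h.

Lemma lcomm_full_sub (K : fieldType) (L : leibniz K) (I : lideal L) :
  {subset ssp (lcomm I (lfull L)) <= ssp (linter I (lcomm (lfull L) (lfull L)))}.
Proof.
apply: (span_sub (f := id)) => // z [x [y [Ix _ E]]].
apply/andP; split; first by case: E => ->; [exact: lid_brl|exact: lid_brr].
by apply: mem_span; exists x, y.
Qed.

(** The quotient [(R :&: [F, F]) / [R, F]], where [R] is the kernel of [p]. *)
Definition lmultiplier_of (K : fieldType) (F L : leibniz K) (p : lhom F L) :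
    leibniz K :=
  lquot (lrestr (lcomm (lker p) (lfull F))
                (linter (lker p) (lcomm (lfull F) (lfull F)))).

Definition is_lmultiplier (K : fieldType) (L A : leibniz K) : Prop :=
  exists E : lext L, lfree (lext_mid E) /\ liso A (lmultiplier_of (lext_p E)).

Definition lstem_cover (K : fieldType) (L : leibniz K) (E : lext L) : Prop :=
  [/\ forall b, lcenter (lext_i E b),
      forall b, lext_i E b \in ssp (lcomm (lfull (lext_mid E)) (lfull (lext_mid E)))
    & is_lmultiplier L (lext_ker E)].

(** * Leibniz crossed modules *)

Record leibniz_action (K : fieldType) (M N : leibniz K)
    (la : M -> N -> N) (ra : N -> M -> N) : Prop := LeibnizAction {
  la_br : forall m m' n, la (br m m') n = la m (la m' n) + ra (la m n) m';
  la_brN : forall m n n', la m (br n n') = br (la m n) n' - br (la m n') n;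
  ra_br : forall n m m', ra n (br m m') = ra (ra n m) m' - ra (ra n m') m;
  ra_brN : forall n n' m, ra (br n n') m = br (ra n m) n' + br n (ra n' m);
  la_la : forall m m' n, la m (la m' n) = - la m (ra n m');
  br_la : forall n m n', br n (la m n') = - br n (ra n' m)
}.

(** [xl q n] is the left action of [q] on [n] and [xr n q] the right one. *)
Record xmod (K : fieldType) := XMod {
  xn : leibniz K;
  xq : leibniz K;
  xd : lhom xn xq;
  xl : {bilinear xq -> xn -> xn};
  xr : {bilinear xn -> xq -> xn};
  xact : leibniz_action xl xr;
  xd_l : forall q n, xd (xl q n) = br q (xd n);
  xd_r : forall n q, xd (xr n q) = br (xd n) q;
  xl_d : forall n1 n2, xl (xd n1) n2 = br n1 n2;
  xr_d : forall n1 n2, xr n1 (xd n2) = br n1 n2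
}.

Record xhom (K : fieldType) (X Y : xmod K) := XHom {
  hn : lhom (xn X) (xn Y);
  hq : lhom (xq X) (xq Y);
  xhom_d : forall n, hq (xd X n) = xd Y (hn n);
  xhom_l : forall q n, hn (xl X q n) = xl Y (hq q) (hn n);
  xhom_r : forall n q, hn (xr X n q) = xr Y (hn n) (hq q)
}.

Definition xsurjective (K : fieldType) (X Y : xmod K) (f : xhom X Y) : Prop :=
  (forall y, exists x, hn f x = y) /\ (forall y, exists x, hq f x = y).

(** Crossed ideals, described by closure conditions; [xideal_kernel] and [xker]
    below show that these are exactly the kernels of homomorphisms. *)
Record xideal (K : fieldType) (X : xmod K) := XIdeal {
  idn : lideal (xn X);
  idq : lideal (xq X);
  xid_d : forall n, n \in ssp idn -> xd X n \in ssp idq;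
  xid_ln : forall q n, n \in ssp idn -> xl X q n \in ssp idn;
  xid_rn : forall n q, n \in ssp idn -> xr X n q \in ssp idn;
  xid_lq : forall q n, q \in ssp idq -> xl X q n \in ssp idn;
  xid_rq : forall n q, q \in ssp idq -> xr X n q \in ssp idn
}.

(** The crossed ideal [I], seen as a crossed module *)
Section CrossedSub.
Variables (K : fieldType) (X : xmod K) (I : xideal X).

Fact xsub_dM (x y : lsub (idn I)) :
  linear_sub (@xid_d K X I) (br x y) =
  @lbracket K (lsub (idq I)) (linear_sub (@xid_d K X I) x)
     (linear_sub (@xid_d K X I) y).
Proof. by apply: val_inj; rewrite /= lhomM. Qed.
Let sd : lhom (lsub (idn I)) (lsub (idq I)) :=
  @LHom K (lsub (idn I)) (lsub (idq I)) _ xsub_dM.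
Let sl := bilin_sub (fun q n (_ : q \in ssp (idq I)) => @xid_ln K X I q n).
Let sr := bilin_sub (fun n q In (_ : q \in ssp (idq I)) => @xid_rn K X I n q In).

Definition xsub : xmod K.
Proof.
apply: (@XMod K (lsub (idn I)) (lsub (idq I)) sd sl sr).
- by split=> *; apply: val_inj => /=;
    rewrite (la_br (xact X), la_brN (xact X), ra_br (xact X), ra_brN (xact X),
             la_la (xact X), br_la (xact X)).
- by move=> q n; apply: val_inj; rewrite /= xd_l.
- by move=> n q; apply: val_inj; rewrite /= xd_r.
- by move=> n1 n2; apply: val_inj; rewrite /= xl_d.
- by move=> n1 n2; apply: val_inj; rewrite /= xr_d.
Defined.
End CrossedSub.

Section CrossedQuotient.
Variables (K : fieldType) (X : xmod K) (I : xideal X).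

Let qnE x y : @lbracket K (lquot (idn I)) (vquot_pi (idn I) x) (vquot_pi (idn I) y) =
  vquot_pi (idn I) (br x y).
Proof. exact: bilin_quotE. Qed.
Let qqE x y : @lbracket K (lquot (idq I)) (vquot_pi (idq I) x) (vquot_pi (idq I) y) =
  vquot_pi (idq I) (br x y).
Proof. exact: bilin_quotE. Qed.
Let repn (x : lquot (idn I)) : exists y, x = vquot_pi (idn I) y.
Proof. by exists (repr x); rewrite vquot_reprK. Qed.
Let repq (x : lquot (idq I)) : exists y, x = vquot_pi (idq I) y.
Proof. by exists (repr x); rewrite vquot_reprK. Qed.

Let fd := linear_quot (@xid_d K X I).
Let fdE n : fd (vquot_pi (idn I) n) = vquot_pi (idq I) (xd X n).
Proof. exact: linear_quotE. Qed.
Fact xquot_dM (x y : lquot (idn I)) :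
  fd (br x y) = @lbracket K (lquot (idq I)) (fd x) (fd y).
Proof.
have [[{}x ->] [{}y ->]] := (repn x, repn y).
rewrite qnE (fdE (br x y)) (fdE x) (fdE y) lhomM.
exact/esym/qqE.
Qed.
Let qd : lhom (lquot (idn I)) (lquot (idq I)) :=
  @LHom K (lquot (idn I)) (lquot (idq I)) fd xquot_dM.
Let ql := bilin_quot (@xid_lq K X I) (@xid_ln K X I).
Let qr := bilin_quot (fun n q => @xid_rn K X I n q) (@xid_rq K X I).

Let qdE n : qd (vquot_pi (idn I) n) = vquot_pi (idq I) (xd X n).
Proof. exact: linear_quotE. Qed.
Let qlE q n : ql (vquot_pi (idq I) q) (vquot_pi (idn I) n) =
  vquot_pi (idn I) (xl X q n).
Proof. exact: bilin_quotE. Qed.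
Let qrE n q : qr (vquot_pi (idn I) n) (vquot_pi (idq I) q) =
  vquot_pi (idn I) (xr X n q).
Proof. exact: bilin_quotE. Qed.
Let qE := (qnE, qqE, qlE, qrE).

Fact xquot_act : @leibniz_action K (lquot (idq I)) (lquot (idn I)) ql qr.
Proof.
split.
- move=> m m' n; have [[{}m ->] [{}m' ->]] := (repq m, repq m').
  by have [{}n ->] := repn n; rewrite !qE (la_br (xact X)) linearD.
- move=> m n n'; have [[{}n ->] [{}n' ->]] := (repn n, repn n').
  by have [{}m ->] := repq m; rewrite !qE (la_brN (xact X)) linearB.
- move=> n m m'; have [[{}m ->] [{}m' ->]] := (repq m, repq m').
  by have [{}n ->] := repn n; rewrite !qE (ra_br (xact X)) linearB.
- move=> n n' m; have [[{}n ->] [{}n' ->]] := (repn n, repn n').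
  by have [{}m ->] := repq m; rewrite !qE (ra_brN (xact X)) linearD.
- move=> m m' n; have [[{}m ->] [{}m' ->]] := (repq m, repq m').
  by have [{}n ->] := repn n; rewrite !qE (la_la (xact X)) linearN.
- move=> n m n'; have [[{}n ->] [{}n' ->]] := (repn n, repn n').
  by have [{}m ->] := repq m; rewrite !qE (br_la (xact X)) linearN.
Qed.

Definition xquot : xmod K.
Proof.
apply: (@XMod K (lquot (idn I)) (lquot (idq I)) qd ql qr xquot_act).
- move=> q n; have [[{}q ->] [{}n ->]] := (repq q, repn n).
  by rewrite qlE (qdE n) (qdE (xl X q n)) xd_l; apply/esym/qqE.
- move=> n q; have [[{}q ->] [{}n ->]] := (repq q, repn n).
  by rewrite qrE (qdE n) (qdE (xr X n q)) xd_r; apply/esym/qqE.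
- move=> n m; have [[{}n ->] [{}m ->]] := (repn n, repn m).
  by rewrite qdE qlE qnE xl_d.
- move=> n m; have [[{}n ->] [{}m ->]] := (repn n, repn m).
  by rewrite qdE qrE qnE xr_d.
Defined.

Definition xquot_pi : xhom X xquot.
Proof.
apply: (@XHom K X xquot (lquot_pi (idn I)) (lquot_pi (idq I))).
- by move=> n; rewrite [RHS]qdE.
- by move=> q n; rewrite [RHS]qlE.
- by move=> n q; rewrite [RHS]qrE.
Defined.
End CrossedQuotient.

Section CrossedIdeals.
Variables (K : fieldType) (X : xmod K).

Definition xfull : xideal X :=
  @XIdeal K X (lfull (xn X)) (lfull (xq X)) (fun _ _ => isT)
    (fun _ _ _ => isT) (fun _ _ _ => isT) (fun _ _ _ => isT) (fun _ _ _ => isT).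

Definition xinter (I J : xideal X) : xideal X.
Proof.
apply: (@XIdeal K X (linter (idn I) (idn J)) (linter (idq I) (idq J))).
- by move=> n /andP[In Jn]; apply/andP; split; apply: xid_d.
- by move=> q n /andP[In Jn]; apply/andP; split; apply: xid_ln.
- by move=> n q /andP[In Jn]; apply/andP; split; apply: xid_rn.
- by move=> q n /andP[Iq Jq]; apply/andP; split; apply: xid_lq.
- by move=> n q /andP[Iq Jq]; apply/andP; split; apply: xid_rq.
Defined.

Definition xker (Y : xmod K) (f : xhom X Y) : xideal X.
Proof.
apply: (@XIdeal K X (lker (hn f)) (lker (hq f))).
- by move=> n /eqP fn; apply/eqP; rewrite xhom_d fn linear0.
- by move=> q n /eqP fn; apply/eqP; rewrite xhom_l fn linear0r.
- by move=> n q /eqP fn; apply/eqP; rewrite xhom_r fn linear0l.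
- by move=> q n /eqP fq; apply/eqP; rewrite xhom_l fq linear0l.
- by move=> n q /eqP fq; apply/eqP; rewrite xhom_r fq linear0r.
Defined.

Definition xrestr (I J : xideal X) : xideal (xsub J).
Proof.
apply: (@XIdeal K (xsub J) (lrestr (idn I) (idn J)) (lrestr (idq I) (idq J))).
- by move=> n; apply: (@xid_d _ _ I (val n)).
- by move=> q n; apply: (@xid_ln _ _ I (val q) (val n)).
- by move=> n q; apply: (@xid_rn _ _ I (val n) (val q)).
- by move=> q n; apply: (@xid_lq _ _ I (val q) (val n)).
- by move=> n q; apply: (@xid_rq _ _ I (val n) (val q)).
Defined.

Lemma xideal_kernel (I : xideal X) : exists (Y : xmod K) (f : xhom X Y),
  ssp (idn (xker f)) =i ssp (idn I) /\ ssp (idq (xker f)) =i ssp (idq I).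
Proof.
exists (xquot I), (xquot_pi I); split=> x; apply/eqP/idP => [|Ix].
- by move=> x0; rewrite -[x]subr0; apply/vquot_eqP; rewrite linear0.
- by rewrite -(linear0 (vquot_pi (idn I))); apply/vquot_eqP; rewrite subr0.
- by move=> x0; rewrite -[x]subr0; apply/vquot_eqP; rewrite linear0.
- by rewrite -(linear0 (vquot_pi (idq I))); apply/vquot_eqP; rewrite subr0.
Qed.

(** Generators of the first component of the commutator, [D_h(t)] and
    [D_j(s)] for [I = (s, h)] and [J = (t, j)]. Their linear span is already an
    ideal stable under the actions. *)
Definition xcomm_gen (I J : xideal X) (z : xn X) : Prop :=
  (exists h t, [/\ h \in ssp (idq I), t \in ssp (idn J)
                  & z = xl X h t \/ z = xr X t h]) \/
  (exists j s, [/\ j \in ssp (idq J), s \in ssp (idn I)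
                  & z = xl X j s \/ z = xr X s j]).

Section Commutator.
Variables I J : xideal X.
Let G : subspace (xn X) := span (xcomm_gen I J).
Let C : lideal (xq X) := lcomm (idq I) (idq J).

Let G_hl h t : h \in ssp (idq I) -> t \in ssp (idn J) -> xl X h t \in ssp G.
Proof. by move=> Ih Jt; apply: mem_span; left; exists h, t; split=> //; left. Qed.
Let G_hr h t : h \in ssp (idq I) -> t \in ssp (idn J) -> xr X t h \in ssp G.
Proof. by move=> Ih Jt; apply: mem_span; left; exists h, t; split=> //; right. Qed.
Let G_jl j s : j \in ssp (idq J) -> s \in ssp (idn I) -> xl X j s \in ssp G.
Proof. by move=> Jj Is; apply: mem_span; right; exists j, s; split=> //; left. Qed.
Let G_jr j s : j \in ssp (idq J) -> s \in ssp (idn I) -> xr X s j \in ssp G.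
Proof. by move=> Jj Is; apply: mem_span; right; exists j, s; split=> //; right. Qed.

Fact xcomm_ln q n : n \in ssp G -> xl X q n \in ssp G.
Proof.
have ll (q1 q2 : xq X) (m : xn X) :
    xl X q1 (xl X q2 m) = xl X (br q1 q2) m - xr X (xl X q1 m) q2.
  by rewrite (la_br (xact X)) addrK.
apply: (span_sub (f := xl X q)) => [a u v|]; first by rewrite linearPr.
have lr (q1 q2 : xq X) (m : xn X) :
    xl X q1 (xr X m q2) = xr X (xl X q1 m) q2 - xl X (br q1 q2) m.
  by rewrite -[LHS]opprK -(la_la (xact X)) ll opprB.
by move=> _ [|] [h [t [hI tJ []->]]]; rewrite (ll, lr); apply: rpredB;
  by [apply: G_hl; rewrite ?lid_brr ?xid_ln|apply: G_hr; rewrite ?lid_brr ?xid_ln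
     |apply: G_jl; rewrite ?lid_brr ?xid_ln|apply: G_jr; rewrite ?lid_brr ?xid_ln].
Qed.

Fact xcomm_rn n q : n \in ssp G -> xr X n q \in ssp G.
Proof.
have rr' (q1 q2 : xq X) (m : xn X) :
    xr X (xl X q1 m) q2 = xl X (br q1 q2) m + xl X q1 (xr X m q2).
  by rewrite (la_br (xact X)) (la_la (xact X)) addrAC addNr add0r.
have rr (q1 q2 : xq X) (m : xn X) :
    xr X (xr X m q1) q2 = xr X m (br q1 q2) + xr X (xr X m q2) q1.
  by rewrite (ra_br (xact X)) subrK.
apply: (span_sub (f := fun n => xr X n q)) => [a u v|]; first by rewrite linearPl.
move=> _ [|] [h [t [hI tJ []->]]].
- by rewrite rr'; apply: rpredD; [apply: G_hl; rewrite ?lid_brl|apply: G_hl; rewrite ?xid_rn].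
- by rewrite rr; apply: rpredD; [apply: G_hr; rewrite ?lid_brl|apply: G_hr; rewrite ?xid_rn].
- by rewrite rr'; apply: rpredD; [apply: G_jl; rewrite ?lid_brl|apply: G_jl; rewrite ?xid_rn].
- by rewrite rr; apply: rpredD; [apply: G_jr; rewrite ?lid_brl|apply: G_jr; rewrite ?xid_rn].
Qed.

Fact xcomm_d n : n \in ssp G -> xd X n \in ssp C.
Proof.
apply: (span_sub (f := xd X)) => [a u v|]; first by rewrite linearP.
move=> _ [|] [h [t [hI tJ []->]]]; rewrite (xd_l, xd_r); apply: mem_span.
- by exists h, (xd X t); split; [|exact: xid_d|left].
- by exists h, (xd X t); split; [|exact: xid_d|right].
- by exists (xd X t), h; split; [exact: xid_d| |right].
- by exists (xd X t), h; split; [exact: xid_d| |left].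
Qed.

Fact xcomm_lq q n : q \in ssp C -> xl X q n \in ssp G.
Proof.
apply: (span_sub (f := fun q => xl X q n)) => [a u v|]; first by rewrite linearPl.
move=> _ [h [j [hI jJ []->]]]; rewrite (la_br (xact X)); apply: rpredD.
- by apply: G_hl hI _; apply: xid_lq.
- by apply: G_jr jJ _; apply: xid_lq.
- by apply: G_jl jJ _; apply: xid_lq.
- by apply: G_hr hI _; apply: xid_lq.
Qed.

Fact xcomm_rq n q : q \in ssp C -> xr X n q \in ssp G.
Proof.
apply: (span_sub (f := xr X n)) => [a u v|]; first by rewrite linearPr.
move=> _ [h [j [hI jJ []->]]]; rewrite (ra_br (xact X)); apply: rpredB.
- by apply: G_jr jJ _; apply: xid_rq.
- by apply: G_hr hI _; apply: xid_rq.
- by apply: G_hr hI _; apply: xid_rq.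
- by apply: G_jr jJ _; apply: xid_rq.
Qed.

Definition xcomm_n : lideal (xn X).
Proof.
apply: (@LIdeal K (xn X) G) => x y Gx.
  by rewrite -xr_d; apply: xcomm_rn.
by rewrite -xl_d; apply: xcomm_ln.
Defined.

Definition xcomm : xideal X :=
  @XIdeal K X xcomm_n C xcomm_d xcomm_ln xcomm_rn xcomm_lq xcomm_rq.
End Commutator.

End CrossedIdeals.

Definition xle (K : fieldType) (X : xmod K) (I J : xideal X) : Prop :=
  {subset ssp (idn I) <= ssp (idn J)} /\ {subset ssp (idq I) <= ssp (idq J)}.

Lemma xcomm_full_le (K : fieldType) (X : xmod K) (I : xideal X) :
  xle (xcomm I (xfull X)) (xinter I (xcomm (xfull X) (xfull X))).
Proof.
split; last exact: lcomm_full_sub.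
apply: (span_sub (f := id)) => // z Iz; apply/andP; split.
  case: Iz => -[h [t [hI tJ []->]]].
  - exact: xid_lq.
  - exact: xid_rq.
  - exact: xid_ln.
  - exact: xid_rn.
apply: mem_span; case: Iz => -[h [t [hI tJ E]]].
  by left; exists h, t.
by right; exists h, t.
Qed.

Definition xtrivial (K : fieldType) (X : xmod K) (I : xideal X) : Prop :=
  (forall n, n \in ssp (idn I) -> n = 0) /\ (forall q, q \in ssp (idq I) -> q = 0).

Definition xiso (K : fieldType) (X Y : xmod K) : Prop :=
  exists f : xhom X Y, bijective (hn f) /\ bijective (hq f).

(** [0 -> xext_ker -> xext_mid -> X -> 0] *)
Record xext (K : fieldType) (X : xmod K) := XExt {
  xext_ker : xmod K;
  xext_mid : xmod K;
  xext_i : xhom xext_ker xext_mid;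
  xext_p : xhom xext_mid X;
  xext_injn : injective (hn xext_i);
  xext_injq : injective (hq xext_i);
  xext_surj : xsurjective xext_p;
  xext_exactn : forall x, hn xext_p x = 0 <-> exists a, x = hn xext_i a;
  xext_exactq : forall x, hq xext_p x = 0 <-> exists a, x = hq xext_i a
}.

(** Projectivity with respect to surjective homomorphisms *)
Definition xprojective (K : fieldType) (P : xmod K) : Prop :=
  forall (Y Z : xmod K) (g : xhom Y Z) (f : xhom P Z), xsurjective g ->
    exists h : xhom P Y, (forall n, hn g (hn h n) = hn f n) /\
                         (forall q, hq g (hq h q) = hq f q).

(** The quotient [(U :&: [M, M]) / [U, M]], where [U] is the kernel of [p]. *)
Definition xmultiplier_of (K : fieldType) (M X : xmod K) (p : xhom M X) : xmod K :=
  xquot (xrestr (xcomm (xker p) (xfull M))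
                (xinter (xker p) (xcomm (xfull M) (xfull M)))).

(** [A] is a Schur multiplier of [X]. *)
Definition is_xmultiplier (K : fieldType) (X A : xmod K) : Prop :=
  exists E : xext X, xprojective (xext_mid E) /\ xiso A (xmultiplier_of (xext_p E)).

Definition xcentral (K : fieldType) (X : xmod K) (E : xext X) : Prop :=
  xtrivial (xcomm (xker (xext_p E)) (xfull (xext_mid E))).

Definition xstem (K : fieldType) (X : xmod K) (E : xext X) : Prop :=
  xcentral E /\
  xle (xker (xext_p E)) (xcomm (xfull (xext_mid E)) (xfull (xext_mid E))).

Definition xstem_cover (K : fieldType) (X : xmod K) (E : xext X) : Prop :=
  xstem E /\ is_xmultiplier X (xext_ker E).

(* Main.v *)
From HB Require Import structures.
From mathcomp Require Import all_boot all_algebra.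
From mathcomp Require Import boolp classical_sets.
Require Import Defs.

(** Take a presentation [0 -> U -> P -> X -> 0] with [P] projective, and put
    [D = [P, P]], [W = U :&: D] and [C = [U, P]], so that [W / C] is the Schur
    multiplier of [X]. If [T] is a crossed ideal of [P] such that [T / C] is a
    complement of [W / C] in [U / C], then
    [0 -> W / C -> P / T -> X -> 0]
    is a stem cover: its kernel [U / T] is isomorphic to [W / C], it is central
    because [C] is contained in [T], and it lies in the commutator of [P / T]
    because [W] lies in [D].

    It remains to find [T]. The brackets and actions of [P] with [U] take their
    values in [C], so that every pair of subspaces between [C] and [U] respected
    by the structure map [mu] is a crossed ideal. For a Leibniz algebra any
    linear complement will do, and Zorn's lemma gives one
    ([relative_complement]). For a crossed module the two complements have to
    be compatible, which fails for arbitrary linear maps: inside the identity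
    map [V -> V] of a nonzero space, the map [0 -> V] has no complement. Here
    projectivity comes in: the abelianization of [P] is injective
    ([xprojective_ab_inj]), that is, [mu m] lies in [D] only if [m] does. Hence,
    once a complement has been chosen in the first component, its image under
    [mu] meets [W] inside [C], and it can be extended to a complement in the
    second component ([xcomm_ker_compl]).

    Presentations come from free objects. The free Leibniz algebra is a quotient
    of an algebra of terms, and the free crossed module on two sets [A] and [B]
    is the inclusion in the free algebra on [A + B] of the ideal generated by
    [A] ([xfree_extension], [xfree_hom_unique]). *)

Set Implicit Arguments.
Unset Strict Implicit.
Unset Printing Implicit Defensive.

Import GRing.Theory.
Local Open Scope ring_scope.
Local Open Scope quotient_scope.

(* Otherwise rewriting with the equations of these maps matches up to
   unfolding. *)
Local Opaque vquot_pi linear_quot bilin_quot.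

(** * Maps given by their values *)

Definition linear_of (K : fieldType) (V W : lmodType K) (f : V -> W)
    (flin : linear f) : {linear V -> W} :=
  HB.pack_for {linear V -> W} f (GRing.isLinear.Build K V W *:%R f flin).

Definition bilinear_of (K : fieldType) (U V W : lmodType K) (f : U -> V -> W)
    (fbil : bilinear_for *:%R *:%R f) : {bilinear U -> V -> W} :=
  HB.pack_for {bilinear U -> V -> W} f
    (bilinear_isBilinear.Build K U V W *:%R *:%R f fbil).

Definition lhom_of (K : fieldType) (L M : leibniz K) (f : L -> M)
    (flin : linear f) (fM : forall x y, f (br x y) = br (f x) (f y)) : lhom L M :=
  @LHom K L M (linear_of flin) fM.

Definition lhom_id (K : fieldType) (L : leibniz K) : lhom L L :=
  @lhom_of K L L id (fun _ _ _ => erefl) (fun _ _ => erefl).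

Section Composition.
Variables (K : fieldType) (L M N : leibniz K) (g : lhom M N) (f : lhom L M).

Fact lhom_comp_linear : linear (g \o f).
Proof. by move=> a x y; rewrite /= !linearP. Qed.

Fact lhom_compM x y : (g \o f) (br x y) = br ((g \o f) x) ((g \o f) y).
Proof. by rewrite /= !lhomM. Qed.

Definition lhom_comp : lhom L N := lhom_of lhom_comp_linear lhom_compM.

End Composition.

(** * Relative complements of subspaces *)

Section Subspaces.
Variables (K : fieldType) (V : lmodType K).

Fact add_image_closed (W : lmodType K) (S : subspace V) (f : {linear W -> V})
    (T : subspace W) :
  submod_closed ((fun x => `[< exists s t,
    [/\ s \in ssp S, t \in ssp T & x = s + f t] >]) : {pred V}).
Proof.
split=> [|a _ _ /asboolP[s [t [Ss Tt ->]]] /asboolP[s' [t' [Ss' Tt' ->]]]].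
  by apply/asboolP; exists 0, 0; rewrite !rpred0 linear0 addr0.
apply/asboolP; exists (a *: s + s'), (a *: t + t').
by rewrite !rpredD ?rpredZ // linearP scalerDr addrACA.
Qed.

Definition add_image (W : lmodType K) (S : subspace V) (f : {linear W -> V})
    (T : subspace W) : subspace V := Subspace (add_image_closed S f T).

Lemma add_imageP (W : lmodType K) (S : subspace V) (f : {linear W -> V})
    (T : subspace W) x :
  reflect (exists s t, [/\ s \in ssp S, t \in ssp T & x = s + f t])
          (x \in ssp (add_image S f T)).
Proof. exact: asboolP. Qed.

Fact line_linear (u : V) : linear (fun a : K^o => a *: u).
Proof. by move=> a x y; rewrite scalerDl scalerA. Qed.

Definition line (u : V) : {linear K^o -> V} := linear_of (line_linear u).

(** When [C <= W <= U], this says that [T / C] is a complement of [W / C] in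
    [U / C]. *)
Record relative_compl (C W U T : subspace V) : Prop := RelativeCompl {
  rc_low : {subset ssp C <= ssp T};
  rc_up : {subset ssp T <= ssp U};
  rc_cap : forall x, x \in ssp T -> x \in ssp W -> x \in ssp C;
  rc_add : forall x, x \in ssp U ->
    exists t w, [/\ t \in ssp T, w \in ssp W & x = t + w]
}.

(** Zorn's lemma yields a maximal [T] meeting [W] inside [C]; a vector [u] of
    [U] outside [T + W] could be added to [T], since [t + a u] in [W] forces
    [a = 0]. Starting the search at a given [T0] makes it possible to choose
    the second component of a crossed ideal after the first one. *)
Lemma relative_complement (C W U T0 : subspace V) :
  {subset ssp C <= ssp T0} -> {subset ssp T0 <= ssp U} ->
  (forall x, x \in ssp T0 -> x \in ssp W -> x \in ssp C) ->
  exists2 T : subspace V, {subset ssp T0 <= ssp T} & relative_compl C W U T.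
Proof.
move=> CT0 T0U T0W.
pose ok (S : subspace V) := [/\ {subset ssp T0 <= ssp S},
  {subset ssp S <= ssp U} & forall x, x \in ssp S -> x \in ssp W -> x \in ssp C].
pose R (S T : {S | ok S}) := `[< {subset ssp (sval S) <= ssp (sval T)} >].
have ok0 : ok T0 by split.
have [||A Atot|[T [T0T TU TW]] Tmax] := @ZL_preorder {S | ok S} (exist ok T0 ok0) R.
- by move=> S; apply/asboolP.
- by move=> S T Y /asboolP ST /asboolP TY; apply/asboolP => x /ST/TY.
- have [[S0 AS0]|A0] := pselect (exists S, A S); last first.
    by exists (exist ok T0 ok0) => S AS; case: A0; exists S.
  have Bcl : submod_closed
      ((fun x => `[< exists2 S, A S & x \in ssp (sval S) >]) : {pred V}).
    split=> [|a x y /asboolP[S AS Sx] /asboolP[T AT Ty]].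
      by apply/asboolP; exists S0; rewrite ?rpred0.
    apply/asboolP; have [/asboolP ST|/asboolP TS] := Atot _ _ AS AT.
      by exists T => //; apply: rpredD; [exact/rpredZ/ST|].
    by exists S => //; apply: rpredD; [exact: rpredZ|exact: TS].
  have okB : ok (Subspace Bcl).
    split=> [x T0x|x /asboolP[[S [/= _ SU _]] _ /SU] //|x /asboolP[[S [/= _ _ SW]] _ /SW] //].
    by apply/asboolP; exists S0 => //; case: S0 {AS0} => S [/= T0S _ _]; apply: T0S.
  exists (exist ok _ okB) => S AS; apply/asboolP => x Sx.
  by apply/asboolP; exists S.
- exists T => //; split=> // [x /CT0/T0T //|u Uu]; apply: contrapT => uTW.
  have okT' : ok (add_image T (line u) (full K^o)).
    split=> [x T0x|_ /add_imageP[t [a [Tt _ ->]]]|_ /add_imageP[t [a [Tt _ ->]]] Wx].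
    + by apply/add_imageP; exists x, 0; rewrite linear0 addr0 (T0T _ T0x).
    + apply: rpredD; [exact: (TU _ Tt)|exact: rpredZ].
    + have [a0|a_neq0] := eqVneq a 0.
        by move: Wx; rewrite a0 linear0 addr0; apply: (TW _ Tt).
      case: uTW; exists (- (a^-1 *: t)), (a^-1 *: (t + a *: u)).
      split; [by rewrite rpredN rpredZ|by rewrite rpredZ|].
      by rewrite scalerDr addKr scalerA mulVf // scale1r.
  have TT' : R (exist ok T (And3 T0T TU TW)) (exist ok _ okT').
    by apply/asboolP => x Tx; apply/add_imageP; exists x, 0; rewrite linear0 addr0.
  have /asboolP T'T := Tmax _ TT'.
  case: uTW; exists u, 0; rewrite rpred0 addr0; split=> //; apply: T'T.
  by apply/(add_imageP T (line u) (full K^o)); exists 0, 1; rewrite rpred0 add0r /= scale1r.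
Qed.

End Subspaces.

(** * Free Leibniz algebras *)

Section FreeLeibniz.
Variables (K : fieldType) (B : Type).

Inductive term :=
| TGen of B
| TZero
| TAdd of term & term
| TScale of K & term
| TBr of term & term.

HB.instance Definition _ := gen_eqMixin term.
HB.instance Definition _ := gen_choiceMixin term.

Fixpoint term_eval (L : leibniz K) (g : B -> L) (t : term) : L :=
  match t with
  | TGen b => g b
  | TZero => 0
  | TAdd s t => term_eval g s + term_eval g t
  | TScale a s => a *: term_eval g s
  | TBr s t => br (term_eval g s) (term_eval g t)
  end.

(** Identifying the terms that agree in every Leibniz algebra, rather than
    those related by the congruence that the axioms generate, turns each axiom
    of the free algebra into the same axiom in an arbitrary one. *)
Definition term_eq (s t : term) : bool :=
  `[< forall (L : leibniz K) (g : B -> L), term_eval g s = term_eval g t >].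

Fact term_eq_equiv : equiv_class_of term_eq.
Proof.
split=> [s|s t|t s u]; first exact/asboolP.
  by apply/asboolP/asboolP => st L g.
by move=> /asboolP st /asboolP tu; apply/asboolP => L g; rewrite st.
Qed.

Canonical term_equiv := EquivRelPack term_eq_equiv.

Definition free_car : Type := {eq_quot term_equiv}.
HB.instance Definition _ := Choice.on free_car.

Definition free_pi (t : term) : free_car := \pi_{eq_quot term_equiv} t.

Definition free_eval (L : leibniz K) (g : B -> L) (x : free_car) : L :=
  term_eval g (repr (x : {eq_quot term_equiv})).

Lemma free_evalE (L : leibniz K) (g : B -> L) t :
  free_eval g (free_pi t) = term_eval g t.
Proof.
have : term_eq (repr (free_pi t : {eq_quot term_equiv})) t.
  by apply/eqmodP; rewrite reprK.
by move/asboolP; apply.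
Qed.

Lemma free_eval_inj (x y : free_car) :
  (forall (L : leibniz K) (g : B -> L), free_eval g x = free_eval g y) -> x = y.
Proof.
move=> xy; rewrite -[x]reprK -[y]reprK; apply/eqmodP/asboolP => L g.
exact: xy.
Qed.

Lemma free_ind (P : free_car -> Prop) : (forall t, P (free_pi t)) -> forall x, P x.
Proof. by move=> Pt x; rewrite -[x]reprK; apply: Pt. Qed.

Let fadd (x y : free_car) : free_car := free_pi (TAdd (repr x) (repr y)).
Let fopp (x : free_car) : free_car := free_pi (TScale (-1) (repr x)).
Let fscale (a : K) (x : free_car) : free_car := free_pi (TScale a (repr x)).
Let fbr (x y : free_car) : free_car := free_pi (TBr (repr x) (repr y)).

Let faddE (L : leibniz K) (g : B -> L) x y :
  free_eval g (fadd x y) = free_eval g x + free_eval g y.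
Proof. by rewrite free_evalE. Qed.
Let foppE (L : leibniz K) (g : B -> L) x : free_eval g (fopp x) = - free_eval g x.
Proof. by rewrite free_evalE /= scaleN1r. Qed.
Let f0E (L : leibniz K) (g : B -> L) : free_eval g (free_pi TZero) = 0.
Proof. by rewrite free_evalE. Qed.
Let fscaleE (L : leibniz K) (g : B -> L) a x : free_eval g (fscale a x) = a *: free_eval g x.
Proof. by rewrite free_evalE. Qed.
Let fbrE (L : leibniz K) (g : B -> L) x y :
  free_eval g (fbr x y) = br (free_eval g x) (free_eval g y).
Proof. by rewrite free_evalE. Qed.
Let fE := (faddE, foppE, f0E, fscaleE, fbrE).

Fact free_addA : associative fadd.
Proof. by move=> x y z; apply: free_eval_inj => L g; rewrite !fE addrA. Qed.
Fact free_addC : commutative fadd.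
Proof. by move=> x y; apply: free_eval_inj => L g; rewrite !fE addrC. Qed.
Fact free_add0 : left_id (free_pi TZero) fadd.
Proof. by move=> x; apply: free_eval_inj => L g; rewrite !fE add0r. Qed.
Fact free_addN : left_inverse (free_pi TZero) fopp fadd.
Proof. by move=> x; apply: free_eval_inj => L g; rewrite !fE addNr. Qed.

HB.instance Definition _ := GRing.isZmodule.Build free_car
  free_addA free_addC free_add0 free_addN.

Fact free_scaleA a b x : fscale a (fscale b x) = fscale (a * b) x.
Proof. by apply: free_eval_inj => L g; rewrite !fE scalerA. Qed.
Fact free_scale1 : left_id 1 fscale.
Proof. by move=> x; apply: free_eval_inj => L g; rewrite !fE scale1r. Qed.
Fact free_scaleDr : right_distributive fscale +%R.
Proof. by move=> a x y; apply: free_eval_inj => L g; rewrite !fE scalerDr. Qed.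
Fact free_scaleDl x : {morph fscale^~ x : a b / a + b}.
Proof. by move=> a b; apply: free_eval_inj => L g; rewrite !fE scalerDl. Qed.

HB.instance Definition _ := GRing.Zmodule_isLmodule.Build K free_car
  free_scaleA free_scale1 free_scaleDr free_scaleDl.

Fact free_br_bilinear : bilinear_for *:%R *:%R fbr.
Proof.
split=> [y|x] a u v; apply: free_eval_inj => L g; rewrite !fE.
  by rewrite linearPl.
by rewrite linearPr.
Qed.

Fact free_identity (x y z : free_car) :
  bilinear_of free_br_bilinear x (bilinear_of free_br_bilinear y z) =
  bilinear_of free_br_bilinear (bilinear_of free_br_bilinear x y) z
  - bilinear_of free_br_bilinear (bilinear_of free_br_bilinear x z) y.
Proof. by apply: free_eval_inj => L g; rewrite /= !fE leibniz_identity. Qed.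

Definition lfreeon : leibniz K := Leibniz free_identity.

Definition free_gen (b : B) : lfreeon := free_pi (TGen b).

Section Extension.
Variables (L : leibniz K) (g : B -> L).

Fact free_eval_linear : linear (free_eval g : lfreeon -> L).
Proof. by move=> a x y; rewrite !fE. Qed.
Fact free_evalM (x y : lfreeon) :
  free_eval g (br x y) = br (free_eval g x) (free_eval g y).
Proof. exact: fbrE. Qed.
Definition free_lift : lhom lfreeon L := lhom_of free_eval_linear free_evalM.

Lemma free_liftE b : free_lift (free_gen b) = g b.
Proof. exact: free_evalE. Qed.

Lemma free_lift_unique (h : lhom lfreeon L) :
  (forall b, h (free_gen b) = g b) -> h =1 free_lift.
Proof.
move=> hg; apply: free_ind => t; rewrite [RHS]free_evalE.
elim: t => [b||s IHs t IHt|a s IHs|s IHs t IHt] /=.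
- exact: hg.
- exact: (linear0 h).
- rewrite -IHs -IHt -linearD; congr (h _).
  by apply: free_eval_inj => M g'; rewrite fE !free_evalE.
- rewrite -IHs -linearZ; congr (h _).
  by apply: free_eval_inj => M g'; rewrite fE !free_evalE.
- rewrite -IHs -IHt -lhomM; congr (h _).
  by apply: free_eval_inj => M g'; rewrite [RHS]fE !free_evalE.
Qed.

End Extension.

Lemma lfreeon_lfree : lfree lfreeon.
Proof.
exists B, free_gen => L g; exists (free_lift g); first exact: free_liftE.
by move=> h' h'g; apply: free_lift_unique.
Qed.

End FreeLeibniz.
(** * Free crossed modules *)

Section GeneratedIdeal.
Variables (K : fieldType) (L : leibniz K) (G : L -> Prop).

(** The ideal generated by [G] is encoded as the intersection of the ideals that
    contain [G]: a property is proved on all of it by exhibiting one ideal. *)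
Definition lgen_pred : {pred L} :=
  fun x => `[< forall I : lideal L, (forall y, G y -> y \in ssp I) -> x \in ssp I >].

Fact lgen_closed : submod_closed lgen_pred.
Proof.
split=> [|a x y /asboolP Gx /asboolP Gy]; apply/asboolP => I GI.
  exact: rpred0.
by apply: rpredD; [apply/rpredZ/Gx|apply: Gy].
Qed.

Fact lgen_brl x y : x \in ssp (Subspace lgen_closed) ->
  br x y \in ssp (Subspace lgen_closed).
Proof. by move=> /asboolP Gx; apply/asboolP => I GI; apply/lid_brl/Gx. Qed.

Fact lgen_brr x y : y \in ssp (Subspace lgen_closed) ->
  br x y \in ssp (Subspace lgen_closed).
Proof. by move=> /asboolP Gy; apply/asboolP => I GI; apply/lid_brr/Gy. Qed.

Definition lgen : lideal L := LIdeal lgen_brl lgen_brr.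

Lemma mem_lgen x : G x -> x \in ssp lgen.
Proof. by move=> Gx; apply/asboolP => I; apply. Qed.

Lemma lgen_sub (I : lideal L) : (forall y, G y -> y \in ssp I) ->
  {subset ssp lgen <= ssp I}.
Proof. by move=> GI x /asboolP; apply. Qed.

End GeneratedIdeal.

Section Inclusion.
Variables (K : fieldType) (L : leibniz K) (I : lideal L).

Let il (q : L) (n : lsub I) : lsub I := Sub (br q (val n)) (lid_brr q (valP n)).
Let ir (n : lsub I) (q : L) : lsub I := Sub (br (val n) q) (lid_brl q (valP n)).

Fact xincl_l_bilinear : bilinear_for *:%R *:%R il.
Proof.
by split=> [y|x] a u v; apply: val_inj; rewrite /= ?linearPl ?linearPr.
Qed.
Fact xincl_r_bilinear : bilinear_for *:%R *:%R ir.
Proof.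
by split=> [y|x] a u v; apply: val_inj; rewrite /= ?linearPl ?linearPr.
Qed.

Fact lsub_val_linear : linear (val : lsub I -> L).
Proof. by []. Qed.
Definition lsub_val : lhom (lsub I) L := lhom_of lsub_val_linear (fun _ _ => erefl).

Lemma lsub_val_inj : injective lsub_val.
Proof. exact: val_inj. Qed.

Fact xincl_act :
  leibniz_action (bilinear_of xincl_l_bilinear) (bilinear_of xincl_r_bilinear).
Proof.
split=> *; apply: val_inj; rewrite /= !leibniz_identity ?opprB ?subrK //.
by rewrite addrC subrK.
Qed.

Definition xincl : xmod K.
Proof.
by apply: (@XMod K (lsub I) L lsub_val _ _ xincl_act) => // *; apply: val_inj.
Defined.

End Inclusion.

Section Semidirect.
Variables (K : fieldType) (X : xmod K).

Let C : lmodType K := (xn X * xq X)%type.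
Let sbr (x y : C) : C :=
  (br x.1 y.1 + xl X x.2 y.1 + xr X x.1 y.2, br x.2 y.2).

Fact xsemidirect_bilinear : bilinear_for *:%R *:%R sbr.
Proof.
split=> [y|x] a u v; rewrite /sbr /= !(linearPl, linearPr);
  by apply: (congr2 pair) => //=; rewrite !scalerDr [RHS]addrACA [X in _ = X + _]addrACA.
Qed.

(** Each argument may be taken in one of the two factors; when not all of them
    come from the same one, the identity follows from the action axioms. *)
Fact xsemidirect_identity (x y z : C) :
  bilinear_of xsemidirect_bilinear x (bilinear_of xsemidirect_bilinear y z) =
  bilinear_of xsemidirect_bilinear (bilinear_of xsemidirect_bilinear x y) z
  - bilinear_of xsemidirect_bilinear (bilinear_of xsemidirect_bilinear x z) y.
Proof.
case: x y z => [n q] [n' q'] [n'' q'']; rewrite /= /sbr /=.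
apply: (congr2 pair) => /=; last exact: leibniz_identity.
rewrite !(linearDl, linearDr) !leibniz_identity !(la_br (xact X)).
rewrite !(la_brN (xact X)) !(ra_br (xact X)) !(ra_brN (xact X)).
rewrite !(la_la (xact X)) !(br_la (xact X)).
rewrite !opprD !opprK !addrA.
(* The last eight terms of the reordered right-hand side cancel in pairs. *)
rewrite [RHS](ACl (1*10*16*7*2*11*4*13*9*18*3*15*5*17*6*12*8*14)) /=.
by rewrite !addrK.
Qed.

Definition xsemidirect : leibniz K := Leibniz xsemidirect_identity.

Fact xsemidirect_d_linear : linear (fun x : xsemidirect => xd X x.1 + x.2).
Proof. by move=> a x y; rewrite /= linearP scalerDr addrACA. Qed.

Fact xsemidirect_dM (x y : xsemidirect) :
  xd X (br x y).1 + (br x y).2 = br (xd X x.1 + x.2) (xd X y.1 + y.2).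
Proof.
rewrite !linearDl !linearDr /= !linearD lhomM xd_l xd_r.
by rewrite !addrA; congr (_ + _); rewrite addrAC.
Qed.

(** The target of the semidirect product seen as a cat-1-algebra; being a
    homomorphism, it is what allows a map out of a free algebra to be defined
    on both kinds of generators at once. *)
Definition xsemidirect_d : lhom xsemidirect (xq X) :=
  lhom_of xsemidirect_d_linear xsemidirect_dM.

Fact xsemidirect_snd_linear : linear (fun x : xsemidirect => x.2).
Proof. by []. Qed.
Definition xsemidirect_snd : lhom xsemidirect (xq X) :=
  lhom_of xsemidirect_snd_linear (fun _ _ => erefl).

End Semidirect.

Section CrossedComposition.
Variables (K : fieldType) (X Y Z : xmod K) (g : xhom Y Z) (f : xhom X Y).

Definition xhom_comp : xhom X Z.
Proof.
apply: (@XHom K X Z (lhom_comp (hn g) (hn f)) (lhom_comp (hq g) (hq f))).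
- by move=> n; rewrite /= !xhom_d.
- by move=> q n; rewrite /= !xhom_l.
- by move=> n q; rewrite /= !xhom_r.
Defined.

End CrossedComposition.

Definition xhom_id (K : fieldType) (X : xmod K) : xhom X X :=
  @XHom K X X (lhom_id _) (lhom_id _) (fun _ => erefl) (fun _ _ => erefl)
    (fun _ _ => erefl).

Section FreeCrossed.
Variables (K : fieldType) (A B : Type).

Let F : leibniz K := lfreeon K (A + B).
Let genA (x : F) : Prop := exists a, x = free_gen K (inl B a).

(** [xfree_extension] and [xfree_hom_unique] make it the free crossed module on
    [A] in the first component and [B] in the second one. Its structure map is
    injective because the images of [A] in the second component are themselves
    free generators. *)
Definition xfreeon : xmod K := xincl (lgen genA).

Definition xfree_inl (a : A) : xn xfreeon :=
  Sub (free_gen K (inl B a)) (mem_lgen (ex_intro _ a erefl : genA (free_gen K (inl B a)))).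

Definition xfree_inr (b : B) : xq xfreeon := free_gen K (inr A b).

Section Extension.
Variables (X : xmod K) (y : A -> xn X) (z : B -> xq X).

Let phi : lhom F (xsemidirect X) :=
  free_lift (fun u : A + B =>
    match u with inl a => ((y a, 0) : xsemidirect X) | inr b => (0, z b) end).

Let phi_inl a : phi (free_gen K (inl B a)) = (y a, 0).
Proof. exact: free_liftE. Qed.
Let phi_inr b : phi (free_gen K (inr A b)) = (0, z b).
Proof. exact: free_liftE. Qed.

Fact xfree_snd0 (m : xn xfreeon) : (phi (val m)).2 = 0.
Proof.
have := valP m; rewrite /= => /(lgen_sub (I := lker (lhom_comp (xsemidirect_snd X) phi))).
by move=> /(_ _)/eqP; apply=> _ [a ->]; exact/eqP/(congr1 snd (phi_inl a)).
Qed.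

Let hn_fun (m : xn xfreeon) : xn X := (phi (val m)).1.

Fact xfree_hn_linear : linear hn_fun.
Proof. by move=> a u v; rewrite /hn_fun linearP. Qed.

Fact xfree_hnM u v : hn_fun (br u v) = br (hn_fun u) (hn_fun v).
Proof.
rewrite /hn_fun -[val _]/(br (val u) (val v)) lhomM /= !xfree_snd0.
by rewrite linear0l linear0r !addr0.
Qed.

(** On the ideal generated by [A] the second coordinate of [phi] vanishes, so
    that its first coordinate is defined there and is equivariant: in the
    semidirect product, [(n, q)] acts on [(n', 0)] as [d n + q] acts on [n']. *)
Lemma xfree_extension : exists h : xhom xfreeon X,
  (forall a, hn h (xfree_inl a) = y a) /\ (forall b, hq h (xfree_inr b) = z b).
Proof.
unshelve eexists.
  apply: (@XHom K xfreeon X (lhom_of xfree_hn_linear xfree_hnM)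
            (lhom_comp (xsemidirect_d X) phi)).
  - by move=> m; rewrite /= xfree_snd0 addr0.
  - move=> q m; rewrite /= /hn_fun -[val _]/(br q (val m)) lhomM /=.
    by rewrite xfree_snd0 linear0r addr0 linearDl xl_d.
  - move=> m q; rewrite /= /hn_fun -[val _]/(br (val m) q) lhomM /=.
    by rewrite xfree_snd0 linear0l addr0 linearDr xr_d.
split=> [a|b]; first exact: (congr1 fst (phi_inl a)).
by rewrite [LHS](congr1 (fun x : xsemidirect X => xd X x.1 + x.2) (phi_inr b)) /= linear0 add0r.
Qed.

End Extension.

(** The elements of the ideal at which two homomorphisms agree form an ideal of
    the free algebra, and it contains [A]. *)
Lemma xfree_hom_unique (X : xmod K) (f g : xhom xfreeon X) :
  (forall a, hn f (xfree_inl a) = hn g (xfree_inl a)) ->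
  (forall b, hq f (xfree_inr b) = hq g (xfree_inr b)) ->
  hn f =1 hn g /\ hq f =1 hq g.
Proof.
move=> fgA fgB.
have fgq : hq f =1 hq g.
  have gE := free_lift_unique (fun u => erefl (hq g (free_gen K u))).
  move=> x; rewrite (gE x); apply: free_lift_unique => -[a|b]; last exact: fgB.
  have := xhom_d f (xfree_inl a); rewrite fgA -xhom_d; apply.
split=> // m0.
pose E : {pred F} :=
  fun x => `[< exists2 m : xn xfreeon, val m = x & hn f m = hn g m >].
have Ecl : submod_closed E.
  split=> [|a _ _ /asboolP[u <- fu] /asboolP[v <- fv]]; apply/asboolP.
    by exists 0; rewrite ?linear0.
  by exists (a *: u + v); rewrite // !linearP fu fv.
have El x y : x \in ssp (Subspace Ecl) -> br x y \in ssp (Subspace Ecl).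
  move=> /asboolP[u <- fu]; apply/asboolP; exists (xr xfreeon u y) => //.
  by rewrite !xhom_r fu fgq.
have Er x y : y \in ssp (Subspace Ecl) -> br x y \in ssp (Subspace Ecl).
  move=> /asboolP[u <- fu]; apply/asboolP; exists (xl xfreeon x u) => //.
  by rewrite !xhom_l fu fgq.
have /(_ _)/asboolP[] := @lgen_sub _ _ genA (LIdeal El Er) _ (val m0) (valP m0).
  by move=> _ [a ->]; apply/asboolP; exists (xfree_inl a).
by move=> m /val_inj ->.
Qed.

(** Preimages chosen for the images of the generators prescribe a lift, which is
    one because homomorphisms agreeing on the generators are equal. *)
Lemma xfreeon_projective : xprojective xfreeon.
Proof.
move=> Y Z g f [gn gq].
have [y yE] := choice (fun a => gn (hn f (xfree_inl a))).
have [z zE] := choice (fun b => gq (hq f (xfree_inr b))).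
have [h [hA hB]] := xfree_extension y z; exists h.
have [] := @xfree_hom_unique Z (xhom_comp g h) f; last by split.
  by move=> a; rewrite /= hA yE.
by move=> b; rewrite /= hB zE.
Qed.

End FreeCrossed.

Lemma xfree_presentation (K : fieldType) (X : xmod K) :
  exists p : xhom (xfreeon K (xn X) (xq X)) X, xsurjective p.
Proof.
have [p [pA pB]] := @xfree_extension K _ _ X id id; exists p.
by split=> x; [exists (xfree_inl _ _ x) | exists (xfree_inr _ _ x)].
Qed.

(** * Abelianization of a projective crossed module *)

Section AbelianCrossed.
Variables (K : fieldType) (V W : lmodType K) (f : {linear V -> W}).

Fact zero_bilinear (U1 U2 U3 : lmodType K) :
  bilinear_for *:%R *:%R (fun (_ : U1) (_ : U2) => 0 : U3).
Proof. by split=> ? a u v; rewrite /= scaler0 addr0. Qed.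

Fact abelian_identity (U : lmodType K) (x y z : U) :
  bilinear_of (@zero_bilinear U U U) x (bilinear_of (@zero_bilinear U U U) y z) =
  bilinear_of (@zero_bilinear U U U) (bilinear_of (@zero_bilinear U U U) x y) z
  - bilinear_of (@zero_bilinear U U U) (bilinear_of (@zero_bilinear U U U) x z) y.
Proof. by rewrite /= subr0. Qed.

Definition labelian (U : lmodType K) : leibniz K := Leibniz (@abelian_identity U).

Definition xabelian : xmod K.
Proof.
apply: (@XMod K (labelian V) (labelian W)
          (@lhom_of K (labelian V) (labelian W) f (linearP f)
             (fun _ _ => linear0 f))
          (bilinear_of (@zero_bilinear W V V)) (bilinear_of (@zero_bilinear V W V)))
  => //.
- by split=> * /=; rewrite ?subr0 ?addr0 ?oppr0.
- by move=> *; apply: (linear0 f).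
- by move=> *; apply: (linear0 f).
Defined.

End AbelianCrossed.

Lemma xcomm_full_br (K : fieldType) (X : xmod K) x y :
  br x y \in ssp (idn (xcomm (xfull X) (xfull X))).
Proof.
by apply: mem_span; left; exists (xd X x), y; split=> //; left; rewrite xl_d.
Qed.

(** The abelianization [M / D -> F / [F, F]] of a projective [P = (M, F)] is
    injective: with [V = M / D], the projection of [M] onto [V] is a
    homomorphism to the abelian crossed module [V -> 0], and it lifts along the
    surjection from [V -> V], the identity. The second component [F -> V] of
    the lift vanishes on [[F, F]], and composed with [M -> F] it gives back the
    projection of [M] onto [V]. *)
Lemma xprojective_ab_inj (K : fieldType) (P : xmod K) (m : xn P) :
  xprojective P ->
  xd P m \in ssp (idq (xcomm (xfull P) (xfull P))) ->
  m \in ssp (idn (xcomm (xfull P) (xfull P))).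
Proof.
move=> projP mF; set D := idn (xcomm (xfull P) (xfull P)).
pose V : lmodType K := vquot D; pose O : lmodType K := 'rV[K]_0.
have pi0 x : x \in ssp D -> vquot_pi D x = 0.
  by move=> Dx; rewrite -(linear0 (vquot_pi D)); apply/vquot_eqP; rewrite subr0.
have idV : linear (id : V -> V) by [].
have toO (U : lmodType K) : linear (fun _ : U => 0 : O).
  by move=> a x y; rewrite /= scaler0 addr0.
pose Y := xabelian (linear_of idV); pose Z := xabelian (linear_of (toO V)).
have [f fE] : exists f : xhom P Z, hn f =1 vquot_pi D.
  have fM (x y : xn P) : vquot_pi D (br x y) = 0 :> labelian V.
    exact/pi0/xcomm_full_br.
  unshelve eexists.
    apply: (@XHom K P Z (@lhom_of K (xn P) (labelian V) (vquot_pi D)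
                           (@vquot_pi_linear K (xn P) D) fM)
              (@lhom_of K (xq P) (labelian O) _ (toO (xq P)) (fun _ _ => erefl))) => //.
    + by move=> q n; apply/pi0/mem_span; left; exists q, n; split=> //; left.
    + by move=> n q; apply/pi0/mem_span; left; exists q, n; split=> //; right.
  by [].
have [g gE] : exists g : xhom Y Z, hn g =1 id.
  by exists (@XHom K Y Z (lhom_id (labelian V))
               (@lhom_of K (labelian V) (labelian O) _ (toO V) (fun _ _ => erefl))
               (fun _ => erefl) (fun _ _ => erefl) (fun _ _ => erefl)).
have [|h [hE _]] := projP Y Z g f.
  by split=> y; [exists y; apply: gE | exists 0; rewrite thinmx0 [RHS]thinmx0].
have h0 : hq h (xd P m) = 0.
  apply/eqP; move: mF; rewrite /= => mF.
  apply: (@span_sub K _ _ _ (hq h) (zero_space V) _ _ _ mF); first exact: linearP.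
  by move=> _ [x [y [_ _ []->]]]; apply/eqP; rewrite lhomM.
rewrite -[m]subr0; apply/vquot_eqP; rewrite linear0 -fE -hE gE.
by rewrite xhom_d in h0.
Qed.

(** * Quotients of presentations by relative complements *)

Section QuotientHom.
Variables (K : fieldType) (L M : leibniz K) (I : lideal L) (f : lhom L M).
Hypothesis fI : forall x, x \in ssp I -> f x = 0.

Let qf (x : lquot I) : M := f (repr x).

Fact lquot_hom_subproof x : qf (vquot_pi I x) = f x.
Proof. by apply/eqP; rewrite -subr_eq0 -linearB fI ?vquot_repr_pi. Qed.

Fact lquot_hom_linear : linear qf.
Proof.
move=> a x y; rewrite -[x]vquot_reprK -[y]vquot_reprK -linearP.
by rewrite !lquot_hom_subproof linearP.
Qed.

Lemma lquot_brE x y :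
  @lbracket K (lquot I) (vquot_pi I x) (vquot_pi I y) = vquot_pi I (br x y).
Proof. exact/esym/lquot_piM. Qed.

Fact lquot_homM (x y : lquot I) : qf (br x y) = br (qf x) (qf y).
Proof.
rewrite -[x]vquot_reprK -[y]vquot_reprK lquot_brE.
by rewrite !lquot_hom_subproof lhomM.
Qed.

Definition lquot_hom : lhom (lquot I) M := lhom_of lquot_hom_linear lquot_homM.

Lemma lquot_homE x : lquot_hom (vquot_pi I x) = f x.
Proof. exact: lquot_hom_subproof. Qed.

End QuotientHom.

Lemma lquot_ind (K : fieldType) (L : leibniz K) (I : lideal L)
    (P : lquot I -> Prop) : (forall x, P (vquot_pi I x)) -> forall x, P x.
Proof. by move=> Px x; rewrite -[x]vquot_reprK. Qed.

Lemma lquot_pi_eq0 (K : fieldType) (L : leibniz K) (I : lideal L) x :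
  vquot_pi I x = 0 <-> x \in ssp I.
Proof.
rewrite -{2}[x]subr0; split=> [x0|Ix]; first by apply/vquot_eqP; rewrite linear0.
by rewrite -(linear0 (vquot_pi I)); apply/vquot_eqP.
Qed.

Section QuotientExtension.
Variables (K : fieldType) (F L : leibniz K) (p : lhom F L) (C W T : lideal F).
Hypothesis WU : {subset ssp W <= ssp (lker p)}.
Hypothesis rcT : relative_compl C W (lker p) T.

Let iota : lhom (lsub W) (lquot T) := lhom_comp (lquot_pi T) (lsub_val W).

Fact compl_iota0 x : x \in ssp (lrestr C W) -> iota x = 0.
Proof. by move=> Cx; apply/lquot_pi_eq0/(rc_low rcT). Qed.

Fact compl_p0 x : x \in ssp T -> p x = 0.
Proof. by move/(rc_up rcT)/eqP. Qed.

(** Taking [W / C] itself as the kernel term, rather than the kernel [U / T] of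
    [compl_p], makes the extension start from the multiplier when [W] and [C]
    come from a presentation. *)
Definition compl_i : lhom (lquot (lrestr C W)) (lquot T) := lquot_hom compl_iota0.
Definition compl_p : lhom (lquot T) L := lquot_hom compl_p0.

Lemma compl_iE x : compl_i (vquot_pi _ x) = vquot_pi T (val x).
Proof. exact: lquot_homE. Qed.

Lemma compl_pE x : compl_p (vquot_pi T x) = p x.
Proof. exact: lquot_homE. Qed.

Lemma compl_i_inj : injective compl_i.
Proof.
suff i0 x : compl_i x = 0 -> x = 0.
  by move=> x y /eqP; rewrite -subr_eq0 -linearB => /eqP/i0/eqP; rewrite subr_eq0 => /eqP.
elim/lquot_ind: x => x; rewrite compl_iE => /lquot_pi_eq0 Tx.
by apply/lquot_pi_eq0/(rc_cap rcT) => //; apply: valP.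
Qed.

(** The kernel of [compl_p] is [U / T], where [U = lker p]; since [U = T + W],
    each of its classes contains an element of [W]. *)
Lemma compl_exact x : compl_p x = 0 <-> exists a, x = compl_i a.
Proof.
elim/lquot_ind: x => x; rewrite compl_pE; split=> [/eqP/(rc_add rcT)|[a]].
  move=> [t [w [Tt Ww ->]]]; exists (vquot_pi _ (Sub w Ww : lsub W)).
  by rewrite compl_iE vquot_piD (proj2 (lquot_pi_eq0 T t) Tt) add0r.
elim/lquot_ind: a => a; rewrite compl_iE => E.
by rewrite -compl_pE E compl_pE; apply/eqP/WU/valP.
Qed.

Lemma compl_ker x : compl_p x = 0 -> exists2 u, p u = 0 & x = vquot_pi T u.
Proof. by elim/lquot_ind: x => x; rewrite compl_pE; exists x. Qed.

End QuotientExtension.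

(** * Stem covers of Leibniz algebras *)

Section PresentationExtension.
Variables (K : fieldType) (F L : leibniz K) (p : lhom F L).
Hypothesis p_surj : forall y, exists x, p x = y.

Fact lker_exact x : p x = 0 <-> exists a, x = lsub_val (lker p) a.
Proof.
split=> [/eqP px|[a ->]]; last by apply/eqP; apply: (valP a).
by exists (Sub x px : lsub (lker p)).
Qed.

Definition lker_ext : lext L := LExt (@lsub_val_inj K F (lker p)) p_surj lker_exact.

End PresentationExtension.

Section LeibnizCover.
Variables (K : fieldType) (F L : leibniz K) (p : lhom F L).
Hypothesis p_surj : forall y, exists x, p x = y.

Let C := lcomm (lker p) (lfull F).
Let D := lcomm (lfull F) (lfull F).
Let W := linter (lker p) D.

(** The brackets of [F] with [lker p] fall in [C], so that every subspace between
    [C] and [lker p] is an ideal. *)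
Lemma lcomm_ker_compl : exists T : lideal F, relative_compl C W (lker p) T.
Proof.
have CU : {subset ssp C <= ssp (lker p)} by move=> x /lcomm_full_sub/andP[].
have [//|//|T CT rcT] := @relative_complement _ _ C W (lker p) C _ CU.
have TU := rc_up rcT.
have Tl x y : x \in ssp T -> br x y \in ssp T.
  by move=> Tx; apply/CT/mem_span; exists x, y; split; [exact: TU| |left].
have Tr x y : y \in ssp T -> br x y \in ssp T.
  by move=> Ty; apply/CT/mem_span; exists y, x; split; [exact: TU| |right].
by exists (LIdeal Tl Tr).
Qed.

Lemma lcomm_full_quot (T : lideal F) x :
  x \in ssp D -> vquot_pi T x \in ssp (lcomm (lfull (lquot T)) (lfull (lquot T))).
Proof.
move=> Dx; apply: (@span_sub K F _ (lquot T) (vquot_pi T) _ _ _ x Dx).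
  exact: vquot_pi_linear.
move=> v [y [z [_ _ E]]].
apply: mem_span; exists (vquot_pi T y), (vquot_pi T z); split=> //.
by rewrite !lquot_brE; case: E => ->; [left|right].
Qed.

Lemma leibniz_stem_cover : lfree F -> exists E : lext L, lstem_cover E.
Proof.
move=> freeF; have [T rcT] := lcomm_ker_compl.
have WU : {subset ssp W <= ssp (lker p)} by move=> x /andP[].
have surj y : exists x, compl_p rcT x = y.
  by have [x <-] := p_surj y; exists (vquot_pi T x); rewrite compl_pE.
have exact_ := compl_exact WU rcT.
exists (@LExt _ _ _ _ (compl_i rcT) (compl_p rcT) (@compl_i_inj _ _ _ _ _ _ _ rcT)
          surj exact_).
split.
- apply: (@lquot_ind _ _ (lrestr C W)) => b; apply: (@lquot_ind _ _ T) => x.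
  rewrite compl_iE !lquot_brE.
  have /andP[Ub _] := valP b.
  by split; apply/lquot_pi_eq0/(rc_low rcT)/mem_span; exists (val b), x; split=> //;
    [left|right].
- apply: (@lquot_ind _ _ (lrestr C W)) => b; rewrite compl_iE; apply: lcomm_full_quot.
  by have /andP[] := valP b.
- exists (lker_ext p_surj); split=> //; exists (lhom_id _); exact: (Bijective (g := id)).
Qed.

End LeibnizCover.

(** * Stem covers of crossed modules *)

Section CrossedCover.
Variables (K : fieldType) (P X : xmod K) (p : xhom P X).
Hypotheses (p_surj : xsurjective p) (projP : xprojective P).

Let U := xker p.
Let C := xcomm U (xfull P).
Let D := xcomm (xfull P) (xfull P).
Let W := xinter U D.

Let C_le_W : xle C W := xcomm_full_le U.

Let CUn : {subset ssp (idn C) <= ssp (idn U)}.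
Proof. by move=> x /(proj1 C_le_W)/andP[]. Qed.
Let CUq : {subset ssp (idq C) <= ssp (idq U)}.
Proof. by move=> x /(proj2 C_le_W)/andP[]. Qed.

Let Cxl_n q n : n \in ssp (idn U) -> xl P q n \in ssp (idn C).
Proof. by move=> Un; apply: mem_span; right; exists q, n; split=> //; left. Qed.
Let Cxr_n n q : n \in ssp (idn U) -> xr P n q \in ssp (idn C).
Proof. by move=> Un; apply: mem_span; right; exists q, n; split=> //; right. Qed.
Let Cxl_q q n : q \in ssp (idq U) -> xl P q n \in ssp (idn C).
Proof. by move=> Uq; apply: mem_span; left; exists q, n; split=> //; left. Qed.
Let Cxr_q n q : q \in ssp (idq U) -> xr P n q \in ssp (idn C).
Proof. by move=> Uq; apply: mem_span; left; exists q, n; split=> //; right. Qed.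
Let Cbr_l x y : x \in ssp (idq U) -> br x y \in ssp (idq C).
Proof. by move=> Ux; apply: mem_span; exists x, y; split=> //; left. Qed.
Let Cbr_r x y : y \in ssp (idq U) -> br x y \in ssp (idq C).
Proof. by move=> Uy; apply: mem_span; exists y, x; split=> //; right. Qed.

(** Since the brackets and actions of [P] with [U] fall in [C], every pair of
    subspaces between [C] and [U] that [xd P] respects is a crossed ideal.
    After a first component [Tn], the second one must contain the image of
    [Tn]; this is compatible with meeting [W] inside [C] because an element
    of [Tn] sent into the commutator is itself in the commutator, [P] being
    projective. *)
Lemma xcomm_ker_compl : exists T : xideal P,
  relative_compl (idn C) (idn W) (idn U) (idn T) /\
  relative_compl (idq C) (idq W) (idq U) (idq T).
Proof.
have [//|//|Tn CTn rcn] :=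
  @relative_complement _ _ (idn C) (idn W) (idn U) (idn C) _ CUn.
have TUn := rc_up rcn.
pose T0 := add_image (idq C) (xd P) Tn.
have T0U : {subset ssp T0 <= ssp (idq U)}.
  move=> _ /add_imageP[c [t [/CUq Uc /TUn Ut ->]]].
  by apply: rpredD Uc _; apply: xid_d.
have T0W x : x \in ssp T0 -> x \in ssp (idq W) -> x \in ssp (idq C).
  move=> /add_imageP[c [t [Cc Tt ->]]] /andP[_ Dct].
  have Dc : c \in ssp (idq D) by have /andP[] := proj2 C_le_W c Cc.
  have Ddt : xd P t \in ssp (idq D).
    by rewrite -[xd P t](addKr c); apply: rpredD => //; rewrite rpredN.
  have Ct : t \in ssp (idn C).
    apply: (rc_cap rcn Tt); apply/andP; split; first exact: (TUn _ Tt).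
    exact: xprojective_ab_inj.
  by apply: rpredD Cc _; apply: (@xid_d _ _ C).
have CT0 : {subset ssp (idq C) <= ssp T0}.
  by move=> x Cx; apply/add_imageP; exists x, 0; rewrite rpred0 linear0 addr0.
have [Tq T0T rcq] := relative_complement CT0 T0U T0W.
have [CTq TUq] := (rc_low rcq, rc_up rcq).
have Tnl x y : x \in ssp Tn -> br x y \in ssp Tn.
  by move=> Tx; rewrite -xr_d; apply/CTn/Cxr_n/TUn.
have Tnr x y : y \in ssp Tn -> br x y \in ssp Tn.
  by move=> Ty; rewrite -xl_d; apply/CTn/Cxl_n/TUn.
have Tql x y : x \in ssp Tq -> br x y \in ssp Tq.
  by move=> Tx; apply/CTq/Cbr_l/TUq.
have Tqr x y : y \in ssp Tq -> br x y \in ssp Tq.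
  by move=> Ty; apply/CTq/Cbr_r/TUq.
have Td n : n \in ssp Tn -> xd P n \in ssp Tq.
  by move=> Tn_n; apply/T0T/add_imageP; exists 0, n; rewrite rpred0 add0r.
unshelve eexists.
  apply: (@XIdeal K P (LIdeal Tnl Tnr) (LIdeal Tql Tqr)) => //.
  - by move=> q n Tn_n; apply/CTn/Cxl_n/TUn.
  - by move=> n q Tn_n; apply/CTn/Cxr_n/TUn.
  - by move=> q n Tq_q; apply/CTn/Cxl_q/TUq.
  - by move=> n q Tq_q; apply/CTn/Cxr_q/TUq.
by split.
Qed.

Section Quotient.
Variable T : xideal P.
Hypothesis rcn : relative_compl (idn C) (idn W) (idn U) (idn T).
Hypothesis rcq : relative_compl (idq C) (idq W) (idq U) (idq T).

Let piT := xquot_pi T.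
Let piM := xquot_pi (xrestr C W).

Definition xcompl_i : xhom (xmultiplier_of p) (xquot T).
Proof.
apply: (@XHom K (xmultiplier_of p) (xquot T) (compl_i rcn) (compl_i rcq)).
- elim/lquot_ind=> n.
  rewrite -(xhom_d piM n : _ = xd (xmultiplier_of p) (vquot_pi _ n)).
  by rewrite !compl_iE; apply: (xhom_d piT (val n)).
- elim/lquot_ind=> q; elim/lquot_ind=> n.
  rewrite -(xhom_l piM q n : _ = xl (xmultiplier_of p) (vquot_pi _ q) (vquot_pi _ n)).
  by rewrite !compl_iE; apply: (xhom_l piT (val q) (val n)).
- elim/lquot_ind=> n; elim/lquot_ind=> q.
  rewrite -(xhom_r piM n q : _ = xr (xmultiplier_of p) (vquot_pi _ n) (vquot_pi _ q)).
  by rewrite !compl_iE; apply: (xhom_r piT (val n) (val q)).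
Defined.

Definition xcompl_p : xhom (xquot T) X.
Proof.
apply: (@XHom K (xquot T) X (compl_p rcn) (compl_p rcq)).
- elim/lquot_ind=> n; rewrite -(xhom_d piT n : _ = xd (xquot T) (vquot_pi _ n)).
  by rewrite !compl_pE; apply: xhom_d.
- elim/lquot_ind=> q; elim/lquot_ind=> n.
  rewrite -(xhom_l piT q n : _ = xl (xquot T) (vquot_pi _ q) (vquot_pi _ n)).
  by rewrite !compl_pE; apply: xhom_l.
- elim/lquot_ind=> n; elim/lquot_ind=> q.
  rewrite -(xhom_r piT n q : _ = xr (xquot T) (vquot_pi _ n) (vquot_pi _ q)).
  by rewrite !compl_pE; apply: xhom_r.
Defined.

End Quotient.

Definition xker_ext : xext X.
Proof.
unshelve eapply (@XExt K X (xsub U) P _ p _ _ p_surj).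
- by apply: (@XHom K (xsub U) P (lsub_val (idn U)) (lsub_val (idq U))).
- exact: lsub_val_inj.
- exact: lsub_val_inj.
- exact: lker_exact.
- exact: lker_exact.
Defined.

Lemma xcomm_full_quot (T : xideal P) :
  (forall n, n \in ssp (idn D) ->
     vquot_pi (idn T) n \in ssp (idn (xcomm (xfull (xquot T)) (xfull (xquot T))))) /\
  (forall q, q \in ssp (idq D) ->
     vquot_pi (idq T) q \in ssp (idq (xcomm (xfull (xquot T)) (xfull (xquot T))))).
Proof.
split; last exact: lcomm_full_quot.
move=> n Dn; apply: (@span_sub K (xn P) _ (lquot (idn T)) (vquot_pi (idn T)) _ _ _ n Dn).
  exact: vquot_pi_linear.
move=> v E; apply: mem_span; left.
have [q [m Eqm]] : exists q m, v = xl P q m \/ v = xr P m q.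
  by case: E => -[q [m [_ _ E]]]; exists q, m.
exists (vquot_pi (idq T) q), (vquot_pi (idn T) m); split=> //.
case: Eqm => ->; first by left; apply: (xhom_l (xquot_pi T)).
by right; apply: (xhom_r (xquot_pi T)).
Qed.

Lemma crossed_stem_cover : exists E : xext X, xstem_cover E.
Proof.
have [T [rcn rcq]] := xcomm_ker_compl.
have WUn : {subset ssp (idn W) <= ssp (idn U)} by move=> x /andP[].
have WUq : {subset ssp (idq W) <= ssp (idq U)} by move=> x /andP[].
have surj : xsurjective (xcompl_p rcn rcq).
  by split=> y; [have [x <-] := p_surj.1 y; exists (vquot_pi (idn T) x)
                |have [x <-] := p_surj.2 y; exists (vquot_pi (idq T) x)]; apply: compl_pE.
have injn : injective (hn (xcompl_i rcn rcq)) by apply: compl_i_inj.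
have injq : injective (hq (xcompl_i rcn rcq)) by apply: compl_i_inj.
exists (XExt injn injq surj (compl_exact WUn rcn) (compl_exact WUq rcq)).
split; last first.
  exists xker_ext; split=> //.
  by exists (xhom_id _); split; exact: (Bijective (g := id)).
have kern (n : lquot (idn T)) : n \in ssp (idn (xker (xcompl_p rcn rcq))) ->
    exists2 m, m \in ssp (idn U) & n = vquot_pi (idn T) m.
  by move/eqP/compl_ker => [m /eqP Um ->]; exists m.
have kerq (q : lquot (idq T)) : q \in ssp (idq (xker (xcompl_p rcn rcq))) ->
    exists2 m, m \in ssp (idq U) & q = vquot_pi (idq T) m.
  by move/eqP/compl_ker => [m /eqP Um ->]; exists m.
have piTl := xhom_l (xquot_pi T); have piTr := xhom_r (xquot_pi T).
have CT n : n \in ssp (idn C) -> hn (xquot_pi T) n = 0.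
  by move=> Cn; apply/lquot_pi_eq0/(rc_low rcn).
have CTq q : q \in ssp (idq C) -> hq (xquot_pi T) q = 0.
  by move=> Cq; apply/lquot_pi_eq0/(rc_low rcq).
split; split.
(* Centrality: the generators of the commutator of [U / T] with [P / T] are the
   images of generators of [C]. *)
- move=> n /asboolP; elim=> [{}n|//|a x y _ -> _ ->]; last by rewrite scaler0 addr0.
  case=> -[q [m [Eq Em]]].
    have [q' Uq' ->] := kerq q Eq; elim/lquot_ind: m {Em} => m.
    by case=> ->; [rewrite -[LHS]piTl|rewrite -[LHS]piTr]; apply: CT;
      [exact: Cxl_q|exact: Cxr_q].
  have [m' Um' ->] := kern m Em; elim/lquot_ind: q {Eq} => q.
  by case=> ->; [rewrite -[LHS]piTl|rewrite -[LHS]piTr]; apply: CT;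
      [exact: Cxl_n|exact: Cxr_n].
- move=> q /asboolP; elim=> [{}q|//|a x y _ -> _ ->]; last by rewrite scaler0 addr0.
  move=> [x [y [/kerq[x' Ux' ->] _]]]; elim/lquot_ind: y => y.
  by rewrite !lquot_brE; case=> ->; apply: CTq; [exact: Cbr_l|exact: Cbr_r].
- move=> n /eqP/(compl_exact WUn rcn)[w ->]; elim/lquot_ind: w => w.
  by rewrite compl_iE; apply: (xcomm_full_quot T).1; have /andP[] := valP w.
- move=> q /eqP/(compl_exact WUq rcq)[w ->]; elim/lquot_ind: w => w.
  by rewrite compl_iE; apply: (xcomm_full_quot T).2; have /andP[] := valP w.
Qed.

End CrossedCover.

Theorem corollary4p6 (K : fieldType) :
  (forall X : xmod K, exists E : xext X, xstem_cover E) /\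
  (forall L : leibniz K, exists E : lext L, lstem_cover E).
Proof.
split=> [X|L].
  have [p p_surj] := xfree_presentation X.
  exact: crossed_stem_cover p_surj (@xfreeon_projective _ _ _).
pose p : lhom (lfreeon K L) L := free_lift id.
apply: (@leibniz_stem_cover K _ L p) => [y|]; last exact: lfreeon_lfree.
by exists (free_gen K y); apply: free_liftE.
Qed.
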